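(* Let $n\geq 3k+2$ and let $q\geq 3$ be a prime power. There are no Cameron-Liebler sets of $k$-spaces in $\mathrm{PG}(n,q)$ with parameter $x$ satisfying $$2\leq x\leq \frac{1}{\sqrt[8]{2}}\,q^{\frac n2-\frac{k^2}{4}-\frac{3k}{4}-\frac32}(q-1)^{\frac{k^2}{4}-\frac k4+\frac12}\sqrt{q^2+q+1}.$$
   Context: Dimensions are projective: a $k$-space of $\mathrm{PG}(n,q)$ is a projective subspace of dimension $k$, where $0\le k\le n$ are integers. $\genfrac{[}{]}{0pt}{}{a}{b}$ denotes the Gaussian binomial coefficient, the number of $b$-dimensional subspaces of $\mathbb{F}_q^a$. Let $A$ be the real incidence matrix of $\mathrm{PG}(n,q)$ with rows indexed by points and columns by $k$-spaces. For $n\ge 2k+1$, a Cameron-Liebler set of $k$-spaces in $\mathrm{PG}(n,q)$ is a set $\mathcal{L}$ of $k$-spaces whose characteristic vector $\chi$ lies in $\operatorname{Im}(A^T)$ (the row space of $A$); its parameter is the rational number $x=|\mathcal{L}|\genfrac{[}{]}{0pt}{}{n}{k}^{-1}$, not necessarily an integer.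
   Formalization: The theorem is proved for k ≥ 1. For k = 0 the claim is false: every set of points is a Cameron-Liebler set with x equal to its size, and the upper bound exceeds 2 for all n ≥ 2 and q ≥ 3, so any two points are a counterexample. *)

(* Defs.v *)
From HB Require Import structures.
From mathcomp Require Import all_boot all_order all_algebra.
From mathcomp Require Import all_classical all_reals all_analysis.

Set Implicit Arguments.
Unset Strict Implicit.
Unset Printing Implicit Defensive.

Import Order.TTheory GRing.Theory Num.Theory.

Local Open Scope ring_scope.

Section FiniteVspace.
Import VectorInternalTheory.
Variables (F : finFieldType) (vT : vectType F).
HB.instance Definition _ := [Finite of {vspace vT} by <:].
End FiniteVspace.

(* PG(n, q), q = #|F|, is the lattice of linear subspaces of F^(n+1); a subspace
   of projective dimension k has linear dimension k + 1. *)
Definition kspace (F : finFieldType) (n k : nat) : finType :=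
  {U : {vspace 'rV[F]_n.+1} | \dim U == k.+1}.

Definition point (F : finFieldType) (n : nat) : finType := kspace F n 0.

(* The number of b-dimensional linear subspaces of F^a. *)
Definition gauss_binom (F : finFieldType) (a b : nat) : nat :=
  #|[set U : {vspace 'rV[F]_a} | \dim U == b]|.

Definition incidence_mx (R : realType) (F : finFieldType) (n k : nat) :
    'M[R]_(#|point F n|, #|kspace F n k|) :=
  \matrix_(i, j) ((val (enum_val i) <= val (enum_val j))%VS)%:R.

Definition char_vec (R : realType) (F : finFieldType) (n k : nat)
    (L : {set kspace F n k}) : 'rV[R]_#|kspace F n k| :=
  \row_j (enum_val j \in L)%:R.

(* As vectors are rows here, Im(A^T) is the row space of A. *)
Definition cameron_liebler (R : realType) (F : finFieldType) (n k : nat)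
    (L : {set kspace F n k}) : bool :=
  (char_vec R L <= incidence_mx R F n k)%MS.

Definition parameter (F : finFieldType) (n k : nat)
    (L : {set kspace F n k}) : rat :=
  #|L|%:R / (gauss_binom F n k)%:R.

(* Main.v *)
Require Import Defs.
From mathcomp Require Import all_boot all_order all_algebra.
From mathcomp Require Import all_classical all_reals all_analysis.
From mathcomp Require Import finfield.
From mathcomp Require Import zify ring lra.

(** Let K = k + 1 and N = n + 1 be the linear dimensions, and let l_j be the
    number of K-spaces through a given j-space.  That the characteristic vector
    of L is in the row space of the incidence matrix means that the points carry
    real weights for which a K-space weighs 1 if it is in L and 0 otherwise.
    The total weight is the parameter x, and members of L subject to a condition
    are counted by adding up weights.  For instance, the number of members of L
    disjoint from a subspace W is x minus the weight of W, times a positive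
    constant ([card_family_disjoint]).  Hence W weighs at most x as soon as
    dim W + K <= N, every member of L meets at least l_1 members, and, the span
    of two disjoint members weighing at most x, few members of L meet both
    ([card_family_meet_two]).

    The heart of the matter is that a nonempty L of small parameter contains a
    pencil, that is, all the K-spaces through some point ([exists_pencil]).  Let
    B be a largest set of pairwise disjoint members of L.  The Bonferroni
    inequality limits the size of B, so that for S in B at least l_1 / 4 members
    of L meet S and no other element of B ([large_clique]).
    These form an intersecting family, since two disjoint ones could replace S
    and enlarge B; and the family is so large that its members share a point
    ([weak_Hilton_Milner]).  Finally, a point on that many members of L has all
    its K-spaces in L: a K-space T through it and outside L would weigh 0, which
    leaves few incidences between the points of T and L ([heavy_vector]).

    Removing a pencil from L gives a Cameron-Liebler set of parameter x - 1.  If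
    x >= 2 it is nonempty, so it contains a pencil as well; but any two pencils
    have a member in common, a contradiction ([weighted_sum_lt2]).

    The bound on x enters only through x^2 q^(2k) <= (17/20) q^n, which follows
    from 2^(-1/4) < 17/20 and (q - 1) (q^2 + q + 1) < q^3 ([bound_sqr_le]). *)

Set Implicit Arguments.
Unset Strict Implicit.
Unset Printing Implicit Defensive.

Import Order.TTheory GRing.Theory Num.Theory.
Local Open Scope ring_scope.

(** * Counting subspaces *)

Section Counting.
Variables (R : realFieldType) (F : finFieldType) (N : nat).
Local Notation V := 'rV[F]_N.
Local Notation q := (#|F|%:R : R).
Implicit Types (S T U W : {vspace V}) (u v : V) (K i j m : nat).

Lemma card_gt1 : 1 < q.
Proof. by rewrite ltr1n finNzRing_gt1. Qed.

Lemma expq_inj_neq i j : (i < j)%N -> q ^+ j - q ^+ i != 0.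
Proof. by move=> ij; rewrite subr_eq0 gt_eqF// ltr_eXn2l// card_gt1. Qed.

Lemma dimV : \dim {: V} = N.
Proof. by rewrite dimvf /dim /= mul1n. Qed.

Lemma sum1_vspace U : \sum_(v in U) 1 = q ^+ \dim U.
Proof. by rewrite sumr_const card_vspace natrX. Qed.

Lemma sum_setD U T (f : V -> R) : (U <= T)%VS ->
  \sum_(v | (v \in T) && (v \notin U)) f v
    = \sum_(v in T) f v - \sum_(v in U) f v.
Proof.
move=> UT; rewrite [X in X - _](bigID (mem U)) /= addrAC.
rewrite -[LHS]add0r; congr (_ + _); apply/esym/eqP; rewrite subr_eq0; apply/eqP.
apply: eq_bigl => v; case: (boolP (v \in U)) => [vU|]; rewrite ?andbF //.
by rewrite (subvP UT).
Qed.

Lemma disjointvP S T :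
  reflect (forall v, v \in S -> v \in T -> v = 0) (S :&: T == 0)%VS.
Proof.
apply: (iffP eqP) => [ST0 v vS vT|ST0].
  by apply/eqP; rewrite -memv0 -ST0 memv_cap vS vT.
apply/vspaceP => v; rewrite memv_cap memv0; apply/andP/eqP => [[]|->].
  exact: ST0.
by rewrite !mem0v.
Qed.

Lemma dim_add_line U v : v \notin U -> \dim (U + <[v]>) = (\dim U).+1.
Proof.
move=> vU; rewrite dimv_disjoint_sum; last first.
  apply/eqP/disjointvP => z zU /vlineP [a zE]; rewrite zE.
  have [->|a0] := eqVneq a 0; first by rewrite scale0r.
  by move: vU; rewrite -[v](scalerK a0) -zE rpredZ.
have v0 : v != 0 by apply: contraNneq vU => ->; rewrite mem0v.
by rewrite dim_vline v0 addn1.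
Qed.

Lemma sub_add_line U v T : (U + <[v]> <= T)%VS = (U <= T)%VS && (v \in T).
Proof. by rewrite subv_add -memvE. Qed.

(** The number of K-spaces that contain a given j-space and are disjoint from a
    given m-space disjoint from that j-space. *)
Definition num_kspaces K j m : R :=
  \prod_(j <= i < K) ((q ^+ N - q ^+ (i + m)) / (q ^+ K - q ^+ i)).

(** Count the pairs (T, v) with v in T but not in U.  Each T gives q^K - q^j of
    them, j = dim U.  The vectors v that occur are those outside U + W, and for
    each of them T ranges over the K-spaces containing U + <v> and disjoint from
    W, whose number is known by induction on K - j. *)
Lemma card_kspaces_disj K U W : (U :&: W = 0)%VS -> (\dim U <= K)%N ->
  #|[set T : {vspace V} | [&& \dim T == K, (U <= T)%VS & (T :&: W == 0)%VS]]|%:R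
    = num_kspaces K (\dim U) (\dim W).
Proof.
move=> UW UK; move dE : (K - \dim U)%N => d.
elim: d U UW UK dE => [|d IH] U UW UK dE.
  have {dE} dU : \dim U = K by apply/eqP; rewrite eqn_leq UK -subn_eq0 dE.
  rewrite /num_kspaces dU big_geq //; transitivity (#|[set U]|%:R : R); last by rewrite cards1.
  congr _%:R; apply: eq_card => T; rewrite !inE.
  apply/and3P/eqP => [[/eqP dT UT _]|->]; last by rewrite dU UW.
  by apply/eqP; rewrite eq_sym eqEdim UT dT dU leqnn.
have jK : (\dim U < K)%N by rewrite -subn_gt0 dE.
rewrite /num_kspaces big_ltn // -/(num_kspaces K (\dim U).+1 (\dim W)).
set A := [set T | _].
have qn0 := expq_inj_neq jK.
apply: (mulfI qn0); rewrite mulrA [(q^+K - _) * (_ / _)]mulrC divfK //.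
transitivity (\sum_(T in A) \sum_(v | (v \in T) && (v \notin U)) (1 : R)).
  rewrite (eq_bigr (fun=> q ^+ K - q ^+ \dim U)) => [|T].
    by rewrite sumr_const mulr_natr.
  by rewrite inE => /and3P[/eqP <- UT _]; rewrite sum_setD // !sum1_vspace.
rewrite (exchange_big_dep (fun v => v \notin U)) /=; last by move=> T v _ /andP[].
rewrite (bigID (fun v => v \in (U + W)%VS)) /= big1 ?add0r; last first.
  move=> v /andP[vU] /memv_addP[u uU [w wW vE]]; apply: big1 => T.
  rewrite inE vU andbT => /andP[/and3P[_ UT /disjointvP TW] vT].
  suff w0 : w = 0 by rewrite vE w0 addr0 uU in vU.
  apply: TW => //; have -> : w = v - u by rewrite vE addrC addKr.
  by rewrite rpredB // (subvP UT).
transitivity (\sum_(v | v \notin (U + W)%VS) num_kspaces K (\dim U).+1 (\dim W)).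
  apply: eq_big => [v|v /andP[vU vUW]].
    by rewrite andb_idl //; apply: contra; apply/subvP/addvSl.
  have vUW' : ((U + <[v]>) :&: W = 0)%VS.
    apply/eqP/disjointvP => z /memv_addP[u uU [_ /vlineP[a ->] zE]] zW.
    have [a0|a0] := eqVneq a 0.
      move: zE; rewrite a0 scale0r addr0 => zE.
      by move/eqP/disjointvP: UW; apply => //; rewrite zE.
    case/negP: vUW; rewrite -[v](scalerK a0) rpredZ //.
    have -> : a *: v = - u + z by rewrite zE addKr.
    by apply: memv_add => //; rewrite rpredN.
  rewrite -(dim_add_line vU) -IH ?dim_add_line //; last by rewrite subnS dE.
  rewrite sumr_const; congr _%:R; apply: eq_card => T.
  by rewrite !inE -topredE /= !inE sub_add_line vU andbT -!andbA [X in _ && (_ && X)]andbC.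
have cE : \sum_(v : V | v \notin (U + W)%VS) (1 : R)
    = q ^+ N - q ^+ (\dim U + \dim W).
  rewrite -(dimv_disjoint_sum UW) -[X in _ = _ ^+ X - _]dimV -!sum1_vspace -sum_setD ?subvf //.
  by apply: eq_bigl => v; rewrite memvf.
by rewrite sumr_const -[LHS]mulr_natl -cE sumr_const.
Qed.

(** The guard matters for K = 2, where a 3-space lies in no K-space while the
    empty product would give 1. *)
Definition num_over K j : R := if (j <= K)%N then num_kspaces K j 0%N else 0.

Lemma card_kspaces_over K U :
  #|[set T : {vspace V} | (\dim T == K) && (U <= T)%VS]|%:R = num_over K (\dim U).
Proof.
rewrite /num_over; case: leqP => [UK|KU].
  rewrite -[X in num_kspaces _ _ X](dimv0 V) -card_kspaces_disj ?capv0 //; congr _%:R.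
  by apply: eq_card => T; rewrite !inE capv0 eqxx andbT.
rewrite (_ : [set T | _] = finset.set0) ?cards0 //; apply/setP => T.
rewrite !inE; apply/negP => /andP[/eqP dT /dimvS].
by rewrite dT leqNgt KU.
Qed.

(** The vectors of the K-spaces over a j-space, counted in two ways. *)
Lemma num_overS K j : num_over K j.+1 * (q ^+ N - q ^+ j)
  = num_over K j * (q ^+ K - q ^+ j).
Proof.
rewrite /num_over; case: (ltngtP j K) => [jK|Kj|->]; rewrite ?mul0r ?subrr ?mulr0 //.
rewrite /num_kspaces [in RHS]big_ltn // addn0.
rewrite [RHS]mulrAC divfK 1?mulrC //; exact: expq_inj_neq.
Qed.

Lemma num_kspaces_factor_ge0 K i m m' : (m' <= m)%N -> (i + m <= N)%N -> (i < K)%N ->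
  0 <= (q ^+ N - q ^+ (i + m)) / (q ^+ K - q ^+ i)
    <= (q ^+ N - q ^+ (i + m')) / (q ^+ K - q ^+ i).
Proof.
move=> mm' imN iK; have q1 := card_gt1.
have d0 : 0 < q ^+ K - q ^+ i by rewrite subr_gt0 ltr_eXn2l.
rewrite divr_ge0 ?(ltW d0) ?subr_ge0 ?ler_eXn2l //=.
by rewrite ler_pM2r ?invr_gt0 // lerD2l lerN2 ler_eXn2l // leq_add2l.
Qed.

Lemma num_kspaces_gt0 K j m : (m + K <= N)%N -> 0 < num_kspaces K j m.
Proof.
move=> mKN; rewrite /num_kspaces big_nat_cond; apply: prodr_gt0 => i.
rewrite andbT => /andP[_ iK]; have q1 := card_gt1.
rewrite divr_gt0 // subr_gt0 ltr_eXn2l //; lia.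
Qed.

Lemma num_kspaces_le_over K j m : (j <= K)%N -> (m + K <= N)%N ->
  num_kspaces K j m <= num_over K j.
Proof.
move=> jK mKN; rewrite /num_over jK /num_kspaces.
rewrite big_nat_cond [leRHS]big_nat_cond; apply: ler_prod => i.
by rewrite andbT => /andP[_ iK]; apply: num_kspaces_factor_ge0 => //; lia.
Qed.

Lemma num_over_ge0 K j : (K <= N)%N -> 0 <= num_over K j.
Proof. by move=> KN; rewrite /num_over; case: ifP => // _; apply/ltW; apply: num_kspaces_gt0. Qed.

Lemma num_over_le K j : (j < K <= N)%N -> num_over K j.+1 <= num_over K j.
Proof.
move=> /andP[jK KN]; have q1 : 1 < q := card_gt1.
have qN : 0 < q ^+ N - q ^+ j by rewrite subr_gt0 ltr_eXn2l // (leq_trans jK).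
rewrite -(ler_pM2r qN) num_overS ler_wpM2l ?num_over_ge0 //.
by rewrite lerD2r ler_eXn2l.
Qed.

Lemma sum_addv S T (f : V -> R) : (S :&: T = 0)%VS ->
  \sum_(z in (S + T)%VS) f z = \sum_(a in S) \sum_(b in T) f (a + b).
Proof.
move=> ST; have TS : (T :&: S = 0)%VS by rewrite capvC.
rewrite pair_big /=.
rewrite (reindex_onto (fun p => p.1 + p.2)
          (fun z => (daddv_pi S T z, daddv_pi T S z))) /=; last first.
  by move=> z zST; rewrite daddv_pi_add.
apply: eq_bigl => -[a b] /=; apply/andP/andP => [[abST /eqP[<- <-]]|[aS bT]].
  by rewrite !memv_pi.
split; first exact: memv_add.
have pi0 A B (z : V) : (A :&: B = 0)%VS -> z \in B -> daddv_pi A B z = 0.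
  move=> AB zB; have := daddv_pi_add AB (subvP (addvSr A B) z zB).
  by rewrite [X in _ + X]daddv_pi_id 1?capvC // -[in RHS](add0r z) => /addIr.
rewrite !linearD /= (daddv_pi_id ST aS) (daddv_pi_id TS bT).
by rewrite (pi0 _ _ _ ST bT) (pi0 _ _ _ TS aS) addr0 add0r.
Qed.

Lemma sum1_nonzero S : \sum_(v in S | v != 0) 1 = q ^+ \dim S - 1.
Proof. by rewrite -sum1_vspace [X in _ = X - 1](bigD1 0) ?mem0v //= addrAC subrr add0r. Qed.

Lemma sum_nonzero_const (y : R) S :
  \sum_(z in S | z != 0) y = (q ^+ \dim S - 1) * y.
Proof. by rewrite -sum1_nonzero mulr_suml; apply: eq_bigr => ? _; rewrite mul1r. Qed.

Lemma mem_line_sym v z : v != 0 -> z != 0 -> (z \in <[v]>%VS) = (v \in <[z]>%VS).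
Proof.
have half (a b : V) : a != 0 -> b \in <[a]>%VS -> b != 0 -> a \in <[b]>%VS.
  move=> a0 /vlineP[c ->] cb; have c0 : c != 0.
    by apply: contraNneq cb => ->; rewrite scale0r.
  by rewrite -[X in X \in _](scalerK c0) rpredZ // memv_line.
by move=> v0 z0; apply/idP/idP => /half; apply.
Qed.

(** A nonzero vector z of S lies on <v> exactly for the q - 1 nonzero
    multiples v of z. *)
Lemma sum_lines S (f : V -> R) :
  \sum_(v in S | v != 0) \sum_(z in <[v]>%VS) f z =
    (q ^+ \dim S - 1) * f 0 + (q - 1) * \sum_(z in S | z != 0) f z.
Proof.
transitivity (\sum_(v in S | v != 0) (f 0 + \sum_(z in <[v]>%VS | z != 0) f z)).
  by apply: eq_bigr => v _; rewrite (bigD1 0) ?mem0v.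
rewrite big_split /= -sum1_nonzero mulr_suml; congr (_ + _).
  by apply: eq_bigr => v _; rewrite mul1r.
rewrite (exchange_big_dep (fun z => (z \in S) && (z != 0))) /=; last first.
  move=> v z /andP[vS v0] /andP[/vlineP[c ->] ->].
  by rewrite rpredZ.
rewrite mulr_sumr; apply: eq_bigr => z /andP[zS z0].
have <- : \sum_(v in <[z]>%VS | v != 0) 1 = q - 1.
  by rewrite sum1_nonzero dim_vline z0.
rewrite mulr_suml; apply: eq_big => [v|v _]; last by rewrite mul1r.
rewrite z0 andbT; apply/idP/idP => [/andP[/andP[vS v0]]|/andP[vz v0]].
  by rewrite v0 mem_line_sym // => ->.
by rewrite v0 mem_line_sym // vz !andbT; case/vlineP: vz => c ->; rewrite rpredZ.
Qed.

(** A subspace meeting S nontrivially contains at least q - 1 nonzero vectors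
    of S. *)
Lemma card_meet_le (A : {set {vspace V}}) S :
  #|[set T in A | (T :&: S != 0)%VS]|%:R * (q - 1)
    <= \sum_(v in S | v != 0) #|[set T in A | v \in T]|%:R.
Proof.
apply: (@le_trans _ _ (\sum_(T in A) \sum_(v | (v \in (T :&: S)%VS) && (v != 0)) (1 : R))); last first.
  rewrite (exchange_big_dep (fun v => (v \in S) && (v != 0))) /=; last first.
    by move=> T v _ /andP[]; rewrite memv_cap => /andP[_ ->].
  apply: ler_sum => v /andP[vS v0]; rewrite sumr_const ler_nat.
  apply: subset_leq_card; apply/fintype.subsetP => T.
  by rewrite !inE -topredE /= memv_cap vS v0 !andbT.
rewrite mulr_natl -sumr_const big_mkcond [leRHS]big_mkcond /=.
apply: ler_sum => T _; rewrite inE; case: (T \in A) => //=.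
have q1 : 1 < q := card_gt1.
rewrite sum1_nonzero; case: ifPn => [TS|_].
  by rewrite lerB // -[leLHS]expr1 ler_eXn2l // lt0n dimv_eq0.
by rewrite subr_ge0 exprn_ege1 // ltW.
Qed.

(** * Intersecting families *)

(** If no point lies on all the members of the family, fix a member T0 and, for
    each of its points v, a member missing v.  Every member contains some point v
    of T0 and some point u of the member missing v; for given u and v it is
    one of the l_2 K-spaces over the line <u, v>.  The powers of q - 1 are there
    because vectors are counted instead of points. *)
Lemma weak_Hilton_Milner K (A : {set {vspace V}}) : (K <= N)%N ->
  (forall T, T \in A -> \dim T = K) ->
  (forall S T, S \in A -> T \in A -> (S :&: T != 0)%VS) ->
  (q ^+ K - 1) ^+ 2 * num_over K 2 < #|A|%:R * (q - 1) ^+ 2 ->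
  exists2 v, v != 0 & forall T, T \in A -> v \in T.
Proof.
move=> KN dA meetA bigA.
have q1 : 0 <= q - 1 by rewrite subr_ge0 ltW // card_gt1.
have [A0|[T0 T0A]] := set_0Vmem A.
  move: bigA; rewrite A0 cards0 mul0r ltNge mulr_ge0 ?sqr_ge0 //.
  exact: num_over_ge0.
have [/existsP[v /andP[v0 /forallP hv]]|] :=
  boolP [exists v : V, (v != 0) && [forall T : {vspace V}, (T \in A) ==> (v \in T)]].
  by exists v => // T TA; apply: (implyP (hv T)).
rewrite negb_exists => /forallP noV; exfalso.
move: bigA; apply/negP; rewrite -leNgt.
have sub_meet (B : {set {vspace V}}) S : S \in A -> B \subset A ->
    [set T in B | (T :&: S != 0)%VS] = B.
  move=> SA /fintype.subsetP BA; apply/setP => T; rewrite inE andb_idr // => TB.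
  by apply: meetA => //; apply: BA.
have sum_const (y : R) S : S \in A -> \sum_(z in S | z != 0) y = (q ^+ K - 1) * y.
  by move=> /dA <-; rewrite sum_nonzero_const.
have two v u S : S \in A -> v \notin S -> u \in S -> u != 0 -> v != 0 ->
  #|[set T in [set T in A | v \in T] | u \in T]|%:R <= num_over K 2.
  move=> SA vS uS u0 v0.
  have d2 : \dim (<[u]> + <[v]>) = 2%N.
    rewrite dim_add_line ?dim_vline ?u0 //.
    by apply: contra vS => /vlineP[c ->]; rewrite rpredZ.
  rewrite -d2 -card_kspaces_over ler_nat; apply: subset_leq_card.
  apply/fintype.subsetP => T; rewrite !inE => /andP[/andP[/dA -> vT] uT].
  by rewrite eqxx subv_add -!memvE uT vT.
have := card_meet_le A T0; rewrite sub_meet // => le0.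
rewrite expr2 mulrA; apply: le_trans (ler_wpM2r q1 le0) _.
rewrite [X in _ <= X * _]expr2 -mulrA -(sum_const _ T0 T0A) mulr_suml.
apply: ler_sum => v /andP[vT0 v0].
have := noV v; rewrite v0 /= negb_forall => /existsP[S].
rewrite negb_imply => /andP[SA vS].
set B := [set T in A | v \in T].
have BA : B \subset A by apply/fintype.subsetP => T; rewrite inE => /andP[].
have := card_meet_le B S; rewrite sub_meet // => /le_trans; apply.
rewrite -(sum_const _ S SA); apply: ler_sum => u /andP[uS u0].
exact: two vS uS u0 v0.
Qed.

(** * Weights of a Cameron-Liebler set *)

(** The additive weights that witness a Cameron-Liebler set.  The weight of a
    point is spread evenly over its q - 1 nonzero vectors: a subspace U has
    q^(dim U) vectors, and direct sums become sums over pairs of vectors, so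
    that the counting below avoids Gaussian coefficients. *)
Record weighted K (w : V -> R) (L : {set {vspace V}}) : Prop := Weighted {
  weight0 : w 0 = 0;
  weighted_dim : forall T, T \in L -> \dim T = K;
  weight_sum : forall T, \dim T = K -> \sum_(v in T) w v = (T \in L)%:R
}.

Section Weighted.
Variables (K : nat) (w : V -> R) (L : {set {vspace V}}).
Hypothesis wL : weighted K w L.
Local Notation wt U := (\sum_(v in U) w v).
Local Notation x := (\sum_v w v).

(** Replace the indicator of L by the weight and exchange the two sums. *)
Lemma card_family_filter (P : pred {vspace V}) :
  #|[set T in L | P T]|%:R =
    \sum_v w v * #|[set T : {vspace V} | [&& \dim T == K, P T & v \in T]]|%:R.
Proof.
transitivity (\sum_(T : {vspace V} | (\dim T == K) && P T) \sum_(v in T) w v).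
  rewrite (eq_bigr (fun T : {vspace V} => (T \in L)%:R)); last first.
    by move=> T /andP[/eqP dT _]; rewrite (weight_sum wL).
  rewrite -natr_sum; congr _%:R; rewrite -sum1_card -big_mkcondr /=.
  apply: eq_bigl => T; rewrite !inE andbC -[RHS]andbA [RHS]andbC -andbA; congr andb.
  by have [TL|//] := boolP (T \in L); rewrite (weighted_dim wL TL) eqxx.
rewrite (exchange_big_dep predT) //=; apply: eq_bigr => v _.
rewrite sumr_const -[LHS]mulr_natr; congr (_ * _%:R); apply: eq_card => T.
by rewrite !inE -topredE /= -andbA.
Qed.

Lemma card_family_over U : #|[set T in L | (U <= T)%VS]|%:R =
  wt U * num_over K (\dim U) + (x - wt U) * num_over K (\dim U).+1.
Proof.
rewrite card_family_filter (bigID (mem U)) /=; congr (_ + _).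
  rewrite mulr_suml; apply: eq_bigr => v vU.
  rewrite -card_kspaces_over; congr (_ * _%:R); apply: eq_card => T.
  by rewrite !inE; congr andb; rewrite andb_idr // => /subvP UT; exact: UT.
rewrite [X in (X - _) * _](bigID (mem U)) /= addrAC subrr add0r mulr_suml.
apply: eq_bigr => v vU; rewrite -(dim_add_line vU) -card_kspaces_over.
by congr (_ * _%:R); apply: eq_card => T; rewrite !inE sub_add_line.
Qed.

Lemma card_family : #|L|%:R = x * num_over K 1.
Proof.
rewrite -[LHS](_ : #|[set T in L | (0 <= T)%VS]|%:R = _).
  rewrite card_family_over dimv0 (eq_bigl (pred1 0)); last by move=> v; rewrite memv0.
  by rewrite big_pred1_eq (weight0 wL) mul0r add0r subr0.
by congr _%:R; apply: eq_card => T; rewrite !inE sub0v andbT.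
Qed.

Lemma card_family_disjoint W : (0 < K)%N -> #|[set T in L | (T :&: W == 0)%VS]|%:R =
  (x - wt W) * num_kspaces K 1 (\dim W).
Proof.
move=> K0; rewrite card_family_filter (bigID (mem W)) /= big1 ?add0r; last first.
  move=> v vW; have [->|v0] := eqVneq v 0; first by rewrite (weight0 wL) mul0r.
  rewrite (_ : [set T | _] = finset.set0) ?cards0 ?mulr0 //; apply/setP => T.
  rewrite !inE; apply/negP => /and3P[_ /disjointvP TW vT].
  by rewrite (TW v) ?eqxx in v0.
rewrite [X in (X - _) * _](bigID (mem W)) /= addrAC subrr add0r mulr_suml.
apply: eq_bigr => v vW.
have v0 : v != 0 by apply: contraNneq vW => ->; rewrite mem0v.
have dv : \dim <[v]> = 1%N by rewrite dim_vline v0.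
rewrite -[X in num_kspaces _ X]dv -card_kspaces_disj ?dv //; last first.
  apply/eqP/disjointvP => z /vlineP[a ->]; have [->|a0] := eqVneq a 0.
    by rewrite scale0r.
  by move=> avW; move: vW; rewrite -[v](scalerK a0) rpredZ.
congr (_ * _%:R); apply: eq_card => T.
by rewrite !inE -memvE; congr andb; rewrite andbC.
Qed.

(** The number of members of L disjoint from W is nonnegative. *)
Lemma weight_le W : (0 < K)%N -> (\dim W + K <= N)%N -> wt W <= x.
Proof.
move=> K0 dW; rewrite -subr_ge0 -(pmulr_lge0 _ (num_kspaces_gt0 1 dW)).
by rewrite -card_family_disjoint.
Qed.

(** The number of members disjoint from S is x - 1 times that of the K-spaces
    through a point that are disjoint from S, and the latter is at most l_1. *)
Lemma card_family_meet S : (0 < K)%N -> (K + K <= N)%N -> S \in L ->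
  num_over K 1 <= #|[set T in L | (T :&: S != 0)%VS]|%:R.
Proof.
move=> K0 KN SL; have dS := weighted_dim wL SL.
have x1 : 1 <= x.
  have : wt S <= x by apply: weight_le; rewrite ?dS.
  by rewrite (weight_sum wL dS) SL.
have := card_family_disjoint S K0; rewrite (weight_sum wL dS) SL dS /= => disjE.
have := num_kspaces_le_over K0 KN.
have := card_family; rewrite -[in #|L|](cardsID [set T : {vspace V} | (T :&: S == 0)%VS] L).
rewrite natrD -[L :&: _](_ : [set T in L | (T :&: S == 0)%VS] = _); last first.
  by apply/setP => T; rewrite !inE.
rewrite disjE -[L :\: _](_ : [set T in L | (T :&: S != 0)%VS] = _); last first.
  by apply/setP => T; rewrite !inE andbC.
move: (num_over K 1) (num_kspaces _ _ _) (#|_|%:R) => a b c E ba; nra.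
Qed.

Lemma sum_nonzero S : \sum_(v in S | v != 0) w v = wt S.
Proof. by rewrite [RHS](bigD1 0) ?mem0v //= (weight0 wL) add0r. Qed.

(** A member of L meeting S1 and S2 contains a line <v1, v2> with v1 in S1 and v2
    in S2, and the number of members over that line is determined by its weight.
    As v1 and v2 vary, the vectors a + b of these lines with a, b nonzero cover
    each vector of S1 + S2 outside S1 and S2 equally often.  So the
    weight of S1 + S2, which is at most x, bounds the total. *)
Lemma card_family_meet_two S1 S2 : (1 < K)%N -> (3 * K <= N)%N ->
  S1 \in L -> S2 \in L -> (S1 :&: S2 = 0)%VS ->
  #|[set T in L | (T :&: S1 != 0)%VS && (T :&: S2 != 0)%VS]|%:R * (q - 1) ^+ 2
   <= (num_over K 2 - num_over K 3)
       * (2 * (q ^+ K - 1) * (q - 1) + (x - 2) * (q - 1) ^+ 2)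
      + (q ^+ K - 1) ^+ 2 * x * num_over K 3.
Proof.
move=> K1 KN S1L S2L S12.
have [d1 d2] := (weighted_dim wL S1L, weighted_dim wL S2L).
have q1 : 0 <= q - 1 by rewrite subr_ge0 ltW // card_gt1.
have [w1 w2] : wt S1 = 1 /\ wt S2 = 1 by rewrite !(weight_sum wL) ?S1L ?S2L.
set l2 := num_over K 2; set l3 := num_over K 3.
have l32 : 0 <= l2 - l3.
  rewrite subr_ge0 /l2 /l3; have [->|K2] := eqVneq K 2%N.
    by rewrite [leLHS]/num_over /= num_over_ge0 //; lia.
  by apply: num_over_le; lia.
apply: (@le_trans _ _ (\sum_(v1 in S1 | v1 != 0) \sum_(v2 in S2 | v2 != 0)
    #|[set T in L | (<[v1]> + <[v2]> <= T)%VS]|%:R)).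
  set A := [set T in L | (T :&: S2 != 0)%VS].
  have -> : [set T in L | (T :&: S1 != 0)%VS && (T :&: S2 != 0)%VS]
    = [set T in A | (T :&: S1 != 0)%VS].
    by apply/setP => T; rewrite !inE -andbA; congr andb; rewrite andbC.
  rewrite expr2 mulrA; apply: le_trans (ler_wpM2r q1 (card_meet_le A S1)) _.
  rewrite mulr_suml; apply: ler_sum => v1 /andP[v1S v10].
  set B := [set T in L | v1 \in T].
  have -> : [set T in A | v1 \in T] = [set T in B | (T :&: S2 != 0)%VS].
    by apply/setP => T; rewrite !inE -!andbA; congr andb; rewrite andbC.
  apply: le_trans (card_meet_le B S2) _; apply: ler_sum => v2 _.
  rewrite ler_nat; apply: subset_leq_card; apply/fintype.subsetP => T.
  by rewrite !inE subv_add -!memvE -!andbA.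
have lineE v1 v2 : v1 \in S1 -> v1 != 0 -> v2 \in S2 -> v2 != 0 ->
  #|[set T in L | (<[v1]> + <[v2]> <= T)%VS]|%:R
    = (l2 - l3) * (\sum_(a in <[v1]>%VS) \sum_(b in <[v2]>%VS) w (a + b)) + x * l3.
  move=> v1S v10 v2S v20.
  have v12 : (<[v1]> :&: <[v2]> = 0)%VS.
    apply/eqP/disjointvP => z z1 z2; move/eqP/disjointvP: S12; apply.
      by move: z1; apply/subvP; rewrite -memvE.
    by move: z2; apply/subvP; rewrite -memvE.
  rewrite card_family_over dimv_disjoint_sum // !dim_vline v10 v20 /=.
  by rewrite sum_addv // -/l2 -/l3; ring.
under eq_bigr => v1 /andP[v1S v10] do under eq_bigr => v2 /andP[v2S v20] do
  rewrite lineE //.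
have sum_const (y : R) S : \dim S = K ->
    \sum_(v in S | v != 0) y = (q ^+ K - 1) * y.
  by move=> <-; rewrite sum_nonzero_const.
under eq_bigr => v1 _ do rewrite big_split /= -mulr_sumr sum_const //.
rewrite big_split /= sum_const // -mulr_sumr.
have ->: \sum_(v1 in S1 | v1 != 0) \sum_(v2 in S2 | v2 != 0)
    \sum_(a in <[v1]>%VS) \sum_(b in <[v2]>%VS) w (a + b)
  = 2 * (q ^+ K - 1) * (q - 1) + (wt (S1 + S2)%VS - 2) * (q - 1) ^+ 2.
  under eq_bigr => v1 _.
    rewrite exchange_big /=.
    under eq_bigr => a _ do rewrite (sum_lines S2 (fun b => w (a + b))) d2 addr0.
    rewrite big_split /= -!mulr_sumr.
    over.
  rewrite big_split /= -!mulr_sumr (sum_lines S1 w) (sum_lines S1 (fun a => \sum_(b in S2 | b != 0) w (a + b))).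
  rewrite d1 (weight0 wL) sum_nonzero w1 /= mulr0 add0r mulr1.
  have -> : \sum_(b in S2 | b != 0) w (0 + b) = 1.
    by rewrite -w2 -sum_nonzero; apply: eq_bigr => b _; rewrite add0r.
  have ->: wt (S1 + S2)%VS = 2 + \sum_(a in S1 | a != 0) \sum_(b in S2 | b != 0) w (a + b).
    rewrite sum_addv // (bigD1 0) ?mem0v //=.
    have -> : \sum_(b in S2) w (0 + b) = 1.
      by rewrite -w2; apply: eq_bigr => b _; rewrite add0r.
    rewrite [2]/(1 + 1) -addrA; congr (_ + _).
    under eq_bigr => a _ do rewrite (bigD1 0) ?mem0v //= addr0.
    by rewrite big_split /= sum_nonzero w1.
  by ring.
have wx : wt (S1 + S2)%VS <= x.
  by apply: weight_le; rewrite ?dimv_disjoint_sum ?d1 ?d2 //; lia.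
rewrite mulrA -expr2 mulrA addrC [leRHS]addrC; apply: lerD => //.
apply: ler_wpM2l => //; rewrite lerD2l; apply: ler_wpM2r; first exact: exprn_ge0.
by rewrite lerD2r.
Qed.

(** Let T be a K-space through v that is not in L.  The number of members of L
    through a point is an affine function of the weight of the point, and the
    weights of the points of T add up to 0; so the members through the points of
    T are, with multiplicity, x l_2 times the number of points of T.  Those
    through v alone are more. *)
Lemma heavy_vector v : v != 0 -> (1 <= K)%N ->
  (q ^+ K - 1) * x * num_over K 2 < (q - 1) * #|[set T in L | v \in T]|%:R ->
  forall T, \dim T = K -> v \in T -> T \in L.
Proof.
move=> v0 K1 heavy T dT vT; apply: contraLR isT => TL; exfalso.
move: heavy; rewrite real_ltNge ?num_real // => /negP; apply.
pose dg z : R := #|[set T in L | z \in T]|%:R.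
have dgE z : z != 0 -> dg z = (num_over K 1 - num_over K 2)
    * (\sum_(y in <[z]>%VS) w y) + x * num_over K 2.
  move=> z0; have := card_family_over <[z]>%VS; rewrite dim_vline z0 /=.
  have -> : [set T in L | (<[z]> <= T)%VS] = [set T in L | z \in T].
    by apply/setP => U; rewrite !inE -memvE.
  by rewrite -/(dg z) => ->; ring.
have TE : \sum_(z in T | z != 0) dg z = (q ^+ K - 1) * x * num_over K 2.
  under eq_bigr => z /andP[_ z0] do rewrite dgE //.
  rewrite big_split /= -mulr_sumr sum_lines sum_nonzero_const dT (weight0 wL) sum_nonzero.
  by rewrite (weight_sum wL dT) (negbTE TL) !mulr0 addr0 mulr0 add0r mulrA.
have vE : \sum_(z in <[v]>%VS | z != 0) dg z = (q - 1) * dg v.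
  have := sum_nonzero_const (dg v) <[v]>%VS; rewrite dim_vline v0 expr1 => <-.
  apply: eq_bigr => z /andP[zv z0].
  congr _%:R; apply: eq_card => U; rewrite !inE.
  case/vlineP: zv z0 => c ->; rewrite scaler_eq0 => /norP[c0 _].
  by rewrite rpredZeq (negbTE c0).
rewrite -TE -/(dg v) -vE big_mkcond [leRHS]big_mkcond /=; apply: ler_sum => z _.
case: ifP => [/andP[zv z0]|_]; last by case: ifP.
by rewrite z0 andbT; case/vlineP: zv => c ->; rewrite rpredZ.
Qed.

End Weighted.

End Counting.

(** * Cliques in a graph with few common neighbours *)

(** Here X stands for the set of K-spaces and e for the relation of meeting
    nontrivially. *)
Section LargeClique.
Variables (R : realFieldType) (X : finType) (e : rel X) (L : {set X}) (m s x : R).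
Implicit Types (B : {set X}) (S T : X).
Hypotheses (e_sym : symmetric e) (e_refl : forall S, S \in L -> e S S).
Hypothesis deg_ge : forall S, S \in L -> m <= #|[set T in L | e T S]|%:R.
Hypothesis codeg_le : forall S1 S2, S1 \in L -> S2 \in L -> ~~ e S1 S2 ->
  #|[set T in L | e T S1 && e T S2]|%:R <= s.

Definition independent (B : {set X}) :=
  (B \subset L) && [forall S in B, forall T in B, (S != T) ==> ~~ e S T].

Lemma independentP (B : {set X}) : reflect
  ({subset B <= L} /\ forall S T, S \in B -> T \in B -> S != T -> ~~ e S T)
  (independent B).
Proof.
apply: (iffP andP) => -[BL BI]; split; first exact/fintype.subsetP.
- move=> S T SB TB ST; move/forall_inP: BI => /(_ _ SB) /forall_inP /(_ _ TB).
  by move/implyP; apply.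
- exact/fintype.subsetP.
apply/forall_inP => S SB; apply/forall_inP => T TB; apply/implyP; exact: BI.
Qed.

Lemma sum_card_set (A : {set X}) (P : pred X) :
  \sum_(T in A) (P T)%:R = #|[set T in A | P T]|%:R :> R.
Proof.
rewrite -natr_sum -big_mkcondr /= sum1_card; congr _%:R.
by apply: eq_card => T; rewrite !inE.
Qed.

Lemma sum_codeg_le B S : independent B -> S \in B ->
  \sum_(S' in B | S' != S) #|[set T in L | e T S && e T S']|%:R
    <= (#|B|%:R - 1) * s.
Proof.
move=> /independentP[BL BI] SB.
have <- : \sum_(S' in B | S' != S) s = (#|B|%:R - 1) * s.
  by rewrite mulrBl mul1r mulr_natl -sumr_const [X in _ = X - _](bigD1 S) //= addrAC subrr add0r.
apply: ler_sum => S' /andP[S'B S'S]; apply: codeg_le; rewrite ?BL //.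
by apply: BI; rewrite // eq_sym.
Qed.

(** If t elements of B are adjacent to T, then (3 t - t^2) / 2 is at most 1; it is
    t minus the number of pairs of such elements. *)
Lemma Bonferroni B : independent B ->
  #|B|%:R * (m - (#|B|%:R - 1) / 2 * s) <= #|L|%:R.
Proof.
move=> IB; have /independentP[BL BI] := IB.
pose t T : nat := #|[set S in B | e T S]|.
have tE T : (t T)%:R = \sum_(S in B) (e T S)%:R :> R by rewrite sum_card_set.
have ptw T : 3 * (t T)%:R - (t T)%:R ^+ 2 <= 2 :> R.
  case: (t T) => [|[|[|n]]]; try by lra.
  have := ler0n R n; rewrite -[n.+3]addn3 natrD; nra.
apply: (@le_trans _ _ (\sum_(T in L) (3 * (t T)%:R - (t T)%:R ^+ 2) / 2)); last first.
  by rewrite -sumr_const; apply: ler_sum => T _; have := ptw T; lra.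
rewrite -mulr_suml sumrB -mulr_sumr.
have sq : \sum_(T in L) (t T)%:R ^+ 2 = \sum_(S in B) \sum_(S' in B)
    #|[set T in L | e T S && e T S']|%:R :> R.
  under [RHS]eq_bigr => S _ do under eq_bigr => S' _ do rewrite -sum_card_set.
  under [RHS]eq_bigr => S _ do rewrite exchange_big /=.
  rewrite exchange_big /=; apply: eq_bigr => T _.
  rewrite expr2 tE mulr_suml; apply: eq_bigr => S _.
  rewrite mulr_sumr; apply: eq_bigr => S' _.
  by case: (e T S) (e T S') => -[]; rewrite ?mulr0 ?mul0r ?mulr1.
have lin : \sum_(T in L) (t T)%:R = \sum_(S in B) #|[set T in L | e T S]|%:R :> R.
  under eq_bigr => T _ do rewrite tE.
  by rewrite exchange_big /=; apply: eq_bigr => S _; rewrite sum_card_set.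
have sq_le : \sum_(T in L) (t T)%:R ^+ 2
    <= \sum_(S in B) #|[set T in L | e T S]|%:R + #|B|%:R * ((#|B|%:R - 1) * s).
  rewrite sq mulr_natl -sumr_const -big_split /=; apply: ler_sum => S SB.
  rewrite (bigD1 S) //= lerD ?sum_codeg_le //.
  by under eq_finset => T do rewrite andbb.
have lin_ge : #|B|%:R * m <= \sum_(T in L) (t T)%:R.
  rewrite lin mulr_natl -sumr_const; apply: ler_sum => S SB; exact/deg_ge/BL.
rewrite lin in lin_ge *; nra.
Qed.

(** Of the neighbours of S in L, discard the common neighbours with each other
    element of B. *)
Lemma private_ge B S : independent B -> S \in B ->
  m - (#|B|%:R - 1) * s
    <= #|[set T in L | e T S && [forall S' in B, (S' != S) ==> ~~ e T S']]|%:R.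
Proof.
move=> IB SB; have /independentP[BL BI] := IB.
rewrite -sum_card_set.
apply: (@le_trans _ _ (\sum_(T in L) ((e T S)%:R
    - \sum_(S' in B | S' != S) (e T S && e T S')%:R))).
  rewrite sumrB sum_card_set exchange_big /= lerB ?deg_ge ?BL //.
  apply: le_trans (sum_codeg_le IB SB); apply: ler_sum => S' _.
  by rewrite sum_card_set.
apply: ler_sum => T TL; case: (boolP (e T S)) => /= TS; last first.
  by rewrite subr_le0 sumr_ge0.
case: (boolP [forall S' in B, _]) => [_|].
  by rewrite lerBlDr lerDl sumr_ge0.
rewrite negb_forall => /existsP[S']; rewrite negb_imply => /andP[S'B].
rewrite negb_imply negbK => /andP[S'S TS'].
by rewrite (bigD1 S') ?S'B //= TS' subr_le0 lerDl sumr_ge0.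
Qed.

(** For B independent of largest size, the members of L adjacent to S in B and to
    no other element of B form a clique, since two non-adjacent ones could replace
    S and enlarge B.  If the clique had fewer than m / 4 elements
    then (#|B| - 1) s > 3 m / 4, and Bonferroni's inequality, applied to a subset
    of B of the least size t + 1 with t s > 3 m / 4, would give
    x s > (15/32) m.  Here 15/32 is the value of y (1 - y/2) at y = 3/4.  Taking
    a minimal t keeps t s in the range where this function stays above that
    value. *)
Lemma large_clique : L != finset.set0 -> 0 < m -> #|L|%:R <= x * m ->
  2 * x * s <= 15 / 16 * m ->
  exists A : {set X}, [/\ A \subset L, (forall S T, S \in A -> T \in A -> e S T)
    & m / 4 <= #|A|%:R].
Proof.
move=> /set0Pn[S0 S0L] m0 Lx small.
have x1 : 1 <= x.
  rewrite -(ler_pM2r m0) mul1r; apply: le_trans Lx; apply: le_trans (deg_ge S0L) _.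
  by rewrite ler_nat; apply: subset_leq_card; apply/fintype.subsetP => T; rewrite inE => /andP[].
have I1 : independent [set S0].
  apply/independentP; split => [S|S T]; rewrite !inE; first by move/eqP->.
  by move=> /eqP-> /eqP->; rewrite eqxx.
case: (arg_maxnP (fun B : {set X} => #|B|) I1) => B IB maxB.
have /independentP[BL BI] := IB.
have B0 : (0 < #|B|)%N by apply: leq_trans (maxB _ I1); rewrite cards1.
have /card_gt0P[S SB] := B0.
have [few|many] := lerP ((#|B|%:R - 1) * s) (3 / 4 * m).
  exists [set T in L | e T S && [forall S' in B, (S' != S) ==> ~~ e T S']].
  split; last 1 first.
  - by apply: le_trans (private_ge IB SB); lra.
  - by apply/fintype.subsetP => T; rewrite inE => /andP[].
  move=> T1 T2; rewrite !inE => /and3P[T1L T1S T1B] /and3P[T2L T2S T2B].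
  have priv T S' : [forall S' in B, (S' != S) ==> ~~ e T S'] ->
      S' \in B -> S' != S -> ~~ e T S'.
    by move=> /forall_inP TB /TB /implyP; apply.
  have notin T : T \in L -> [forall S' in B, (S' != S) ==> ~~ e T S'] -> T \notin B :\ S.
    move=> TL TB; apply/negP; rewrite in_setD1 => /andP[TS TB'].
    by have := priv T T TB TB' TS; rewrite e_refl.
  apply: contraT => T12.
  have T1T2 : T1 != T2 by apply: contraNneq T12 => ->; rewrite e_refl.
  pose C := T1 |: (T2 |: (B :\ S)).
  suff /maxB : independent C.
    rewrite /C !cardsU1 !inE (negbTE T1T2) /=.
    have := notin _ T1L T1B; have := notin _ T2L T2B; rewrite !in_setD1 => -> ->.
    by rewrite (cardsD1 S B) SB /=; move: #|B :\ S| => b; clear; lia.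
  apply/independentP; split=> [U|U1 U2].
    by rewrite !inE => /or3P[/eqP->|/eqP->|/andP[_ /BL]].
  rewrite !inE => /or3P[/eqP->|/eqP->|/andP[U1S U1B]] /or3P[/eqP->|/eqP->|/andP[U2S U2B]];
    rewrite ?eqxx // => U12; rewrite // ?(e_sym T2 T1) //.
  - exact: priv.
  - exact: priv.
  - by rewrite e_sym; exact: priv.
  - by rewrite e_sym; exact: priv.
  - exact: BI.
exfalso.
have ex_t : exists t : nat, 3 / 4 * m < t%:R * s.
  by exists #|B|.-1; rewrite -subn1 natrB.
case: (ex_minnP ex_t) => t t_big t_min.
have tB : (t < #|B|)%N.
  by rewrite -(prednK B0) ltnS; apply: t_min; rewrite -subn1 natrB.
have t0 : (0 < t)%N by case: t t_big {t_min tB} => //; rewrite mul0r; nra.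
have t_small : (t%:R - 1) * s <= 3 / 4 * m.
  rewrite leNgt; apply/negP => big; have := t_min t.-1.
  by rewrite -subn1 natrB // => /(_ big); rewrite subn1 leqNgt ltn_predL t0.
have /card_geqP[r [r_uniq r_size rB]] := tB.
have IC : independent [set S in r].
  apply/independentP; split => [U|U1 U2]; rewrite !inE; first by move/rB/BL.
  by move=> /rB U1B /rB U2B; apply: BI.
have := Bonferroni IC; rewrite cardsE (card_uniqP r_uniq) r_size.
move=> bonf; have {bonf} := le_trans bonf Lx.
have : 0 <= t%:R :> R by [].
rewrite -natr1; move: (t%:R : R) t_big t_small => y y1 y2 y0.
rewrite addrK => bonf.
have s0 : 0 < s by nra.
have : (y * s + s) * (m - y * s / 2) <= x * s * m by nra.
set z := y * s in y1 *.
have z2 : z <= 3 / 4 * m + s by rewrite /z; lra.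
have : s <= 15 / 32 * m by nra.
have [zm|zm] := lerP z m; nra.
Qed.

End LargeClique.

(** * Numerical estimates *)

(** For a = q^k, h = q^n, kappa the number of points of a K-space, rho = l_2 / l_1
    and rho' = l_3 / l_2, these are the three inequalities that the existence of
    a pencil requires.  They amount to bounds for x^2 rho and
    B = x rho (kappa - 1), with x^2 <= (17/20) h / a^2 and rho about a / h: then
    x^2 rho is about (a - 1) / a^2 and B^2 at most about
    (a - 1)^4 / (a^5 (q - 1)^2).
    The tightest case is q = 3, k = 1, n = 5, where h = 243; this explains the
    factor 243/242 >= h / (h - 1).  The cases k = 1 and k >= 2 are separated, as
    rho' = 0 for k = 1 compensates for a larger x^2 rho. *)
Lemma numerical_estimates (R : realFieldType) (q a h x rho rho' kappa : R) :
  3 <= q -> a = q \/ q ^+ 2 <= a -> a ^+ 3 * q ^+ 2 <= h ->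
  1 <= x -> x ^+ 2 * a ^+ 2 <= 17 / 20 * h ->
  rho * (h - 1) = a - 1 -> rho' * (h - q) = a - q ->
  kappa * (q - 1) = a * q - 1 ->
  [/\ kappa ^+ 2 * rho < 1 / 4, x * kappa * rho < 1 / 4 &
    2 * x * (rho * ((1 - rho') * (2 * kappa + x - 2) + kappa ^+ 2 * x * rho'))
      <= 15 / 16].
Proof.
move=> q3 a_cases ah x1 xh rhoE rho'E kappaE.
have aq : q <= a by case: a_cases => [->//|qa]; nra.
have aq9 : 9 <= a * q by clear - aq q3; nra.
have h243 : 243 <= h.
  apply: le_trans ah; rewrite (_ : 243 = 3 ^+ 3 * 3 ^+ 2); last by ring.
  by apply: ler_pM; rewrite ?exprn_ge0 // lerXn2r ?nnegrE //; lra.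
have a0 : 0 < a by lra.
have h1 : 0 < h - 1 by lra.
have q1 : 0 < q - 1 by lra.
have rho0 : 0 <= rho by rewrite -(pmulr_lge0 _ h1) rhoE; lra.
have rho_h : rho * h <= 243 / 242 * (a - 1).
  have rho_h1 : rho * 242 <= rho * (h - 1) by rewrite ler_wpM2l //; lra.
  by rewrite (_ : rho * h = rho * (h - 1) + rho); [lra | ring].
have ha : a < h.
  apply: lt_le_trans ah; rewrite exprS -mulrA ltr_pMr // -exprMn; clear - aq9; nra.
have hq : 0 < h - q by lra.
have /andP[r0 r1] : 0 <= rho' <= rho.
  rewrite -(pmulr_lge0 _ hq) rho'E subr_ge0 aq /=.
  rewrite -(ler_pM2r hq) rho'E -(ler_pM2r h1) mulrAC rhoE.
  by clear - q1 ha; nra.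
have kappa4 : 4 <= kappa.
  by rewrite -(ler_pM2r q1) kappaE; clear - aq q3; nra.
have k2rho : kappa ^+ 2 * rho < 1 / 4.
  have E : (a * q - 1) ^+ 2 * (a - 1) < h - 1.
    apply: (@lt_le_trans _ _ (a ^+ 3 * q ^+ 2 - 1)); last by lra.
    have aq1 : (a * q - 1) ^+ 2 <= (a * q) ^+ 2 - 17 by clear - aq9; nra.
    have : (a * q - 1) ^+ 2 * (a - 1) <= ((a * q) ^+ 2 - 17) * (a - 1).
      by rewrite ler_wpM2r //; lra.
    have : 81 <= (a * q) ^+ 2 by clear - aq9; nra.
    by clear - a0 aq q3; nra.
  have q14 : 4 <= (q - 1) ^+ 2 by clear - q3; nra.
  have d0 : 0 < (q - 1) ^+ 2 * (h - 1) by rewrite mulr_gt0 // exprn_gt0.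
  rewrite -(ltr_pM2r d0).
  have -> : kappa ^+ 2 * rho * ((q - 1) ^+ 2 * (h - 1))
    = (kappa * (q - 1)) ^+ 2 * (rho * (h - 1)) by ring.
  by rewrite kappaE rhoE; apply: (lt_le_trans E); clear - q14 h1; nra.
have A_le : x ^+ 2 * rho * a ^+ 2 <= 17 / 20 * (243 / 242 * (a - 1)).
  rewrite mulrAC; apply: le_trans (ler_wpM2r rho0 xh) _.
  by lra.
have a2 : 0 < a ^+ 2 by rewrite exprn_gt0.
set B := x * rho * (kappa - 1).
have B0 : 0 <= B by rewrite !mulr_ge0 //; clear - x1 kappa4; lra.
have B_sqr : B ^+ 2 * ((q - 1) ^+ 2 * a ^+ 5) <= 8571 / 10000 * (a - 1) ^+ 4.
  have kE : (kappa - 1) * (q - 1) = q * (a - 1) by rewrite mulrBl kappaE; ring.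
  have -> : B ^+ 2 * ((q - 1) ^+ 2 * a ^+ 5) =
     (x ^+ 2 * a ^+ 2) * rho ^+ 2 * (a ^+ 3 * q ^+ 2) * (a - 1) ^+ 2.
    have -> : B ^+ 2 * ((q - 1) ^+ 2 * a ^+ 5)
      = (x * rho) ^+ 2 * a ^+ 5 * ((kappa - 1) * (q - 1)) ^+ 2 by rewrite /B; ring.
    by rewrite kE; ring.
  have -> : (a - 1) ^+ 4 = (a - 1) ^+ 2 * (a - 1) ^+ 2 by ring.
  rewrite [leRHS]mulrA ler_wpM2r ?sqr_ge0 //.
  apply: (@le_trans _ _ (17 / 20 * h * rho ^+ 2 * h)).
    apply: (@le_trans _ _ (17 / 20 * h * rho ^+ 2 * (a ^+ 3 * q ^+ 2))).
      apply: ler_wpM2r; first by rewrite mulr_ge0 ?exprn_ge0 //; clear - a0 q3; lra.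
      by apply: ler_wpM2r; rewrite ?sqr_ge0.
    by apply: ler_wpM2l; rewrite // mulr_ge0 ?sqr_ge0 //; clear - h1; lra.
  have -> : 17 / 20 * h * rho ^+ 2 * h = 17 / 20 * (rho * h) ^+ 2 by ring.
  have rh0 : 0 <= rho * h by rewrite mulr_ge0 //; clear - h1; lra.
  have : (rho * h) ^+ 2 <= (243 / 242 * (a - 1)) ^+ 2.
    exact: lerXn2r rh0 (le_trans rh0 rho_h) rho_h.
  by have := sqr_ge0 (a - 1); rewrite exprMn; clear; lra.
have sqr_le (y : R) : 0 <= y -> B ^+ 2 <= y ^+ 2 -> B <= y.
  by move=> y0; rewrite ler_pXn2r ?nnegrE.
have q5 : 0 < (q - 1) ^+ 2 * a ^+ 5 by rewrite mulr_gt0 // exprn_gt0.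
have AB : (a = q /\ x ^+ 2 * rho <= 19 / 100 /\ B <= 12 / 100)
    \/ (q ^+ 2 <= a /\ x ^+ 2 * rho <= 85 / 1000 /\ B <= 16 / 100).
  case: a_cases => [aE|q2a]; [left|right].
    split=> //; split.
      by rewrite -(ler_pM2r a2); apply: le_trans A_le _; clear - aq q3; nra.
    apply: sqr_le; first by clear; lra.
    rewrite -(ler_pM2r q5); apply: le_trans B_sqr _; rewrite aE.
    have -> : (q - 1) ^+ 4 = (q - 1) ^+ 2 * (q - 1) ^+ 2 by ring.
    rewrite mulrCA [leRHS]mulrCA ler_wpM2l ?sqr_ge0 //.
    (* 2/9 is the largest value of (q - 1) / q^2 for q >= 3. *)
    have E1 : (q - 1) ^+ 2 <= (2 / 9 * q ^+ 2) ^+ 2.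
      by rewrite lerXn2r ?nnegrE //; clear - q3; nra.
    have E2 : (2 / 9 * q ^+ 2) ^+ 2 = 4 / 81 * q ^+ 4 by field.
    have E3 : 3 * q ^+ 4 <= q ^+ 5.
      by rewrite (exprS q 4) ler_wpM2r // exprn_ge0 //; clear - q3; lra.
    have := sqr_ge0 (q - 1).
    by rewrite E2 in E1; clear - E1 E3; lra.
  have a9 : 9 <= a by clear - q2a q3; nra.
  split=> //; split.
    by rewrite -(ler_pM2r a2); apply: le_trans A_le _; clear - a9; nra.
  apply: sqr_le; first by clear; lra.
  rewrite -(ler_pM2r q5); apply: le_trans B_sqr _.
  have E1 : (a - 1) ^+ 4 <= a ^+ 4 by rewrite lerXn2r ?nnegrE //; clear - a9; lra.
  have E2 : 4 * (9 * a ^+ 4) <= (q - 1) ^+ 2 * a ^+ 5.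
    apply: (@le_trans _ _ (4 * a ^+ 5)).
      by rewrite ler_wpM2l // (exprS a 4) ler_wpM2r // exprn_ge0 // ltW.
    by rewrite ler_wpM2r ?exprn_ge0 ?(ltW a0) //; clear - q3; nra.
  by have := exprn_ge0 4 (ltW a0); clear - E1 E2; lra.
split=> //.
  have : x * kappa * rho <= 4 / 3 * B.
    rewrite /B (_ : x * kappa * rho = x * rho * kappa); last by ring.
    rewrite mulrCA ler_wpM2l //; last by clear - kappa4; lra.
    by rewrite mulr_ge0 //; clear - x1; lra.
  by case: AB => -[_ [_]]; clear; lra.
have x0 : 0 <= x by clear - x1; lra.
have xr0 : 0 <= x * rho by rewrite mulr_ge0.
have : x * rho * ((1 - rho') * (2 * kappa + x - 2) + kappa ^+ 2 * x * rho')
   <= 2 * B + x ^+ 2 * rho * (1 + kappa ^+ 2 * rho').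
  have -> : 2 * B + x ^+ 2 * rho * (1 + kappa ^+ 2 * rho')
    = x * rho * (2 * (kappa - 1) + x * (1 + kappa ^+ 2 * rho')) by rewrite /B; ring.
  by apply: ler_wpM2l => //; clear - r0 kappa4 x0; nra.
case: AB => -[aE [A Bb]].
  have -> : rho' = 0 by apply: (mulIf (lt0r_neq0 hq)); rewrite rho'E aE subrr mul0r.
  rewrite !mulr0; move: A Bb; clear; lra.
have k14 : kappa ^+ 2 * rho' <= 1 / 4.
  by apply: le_trans (ltW k2rho); rewrite ler_wpM2l ?sqr_ge0.
have x20 : 0 <= x ^+ 2 * rho by rewrite mulr_ge0 ?sqr_ge0.
have : x ^+ 2 * rho * (1 + kappa ^+ 2 * rho') <= x ^+ 2 * rho * (5 / 4).
  by rewrite ler_wpM2l //; move: k14; clear; lra.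
by move: A Bb; clear; lra.
Qed.

(** * Existence and removal of pencils *)

Section Pencils.
Variables (R : realFieldType) (F : finFieldType) (n k : nat).
Local Notation V := 'rV[F]_n.+1.
Local Notation q := (#|F|%:R : R).
Local Notation l j := (num_over R F n.+1 k.+1 j).
Hypotheses (q_ge3 : (3 <= #|F|)%N) (k_ge1 : (1 <= k)%N) (n_ge : (3 * k + 2 <= n)%N).
Implicit Types (v : V) (S T : {vspace V}).

Lemma num_over_gt0 j : (j <= k.+1)%N -> 0 < l j.
Proof. by move=> jk; rewrite /num_over jk num_kspaces_gt0 //; lia. Qed.

(** The relation of meeting nontrivially has large cliques on L, because every
    member of L has at least l_1 neighbours and disjoint members have few common
    ones.  A clique of size l_1 / 4 is too large for an intersecting family
    without a common point, and that point is on enough members of L to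
    have its whole pencil in L. *)
Lemma exists_pencil (w : V -> R) (L : {set {vspace V}}) : weighted k.+1 w L ->
  L != finset.set0 -> (\sum_v w v) ^+ 2 * (q ^+ k) ^+ 2 <= 17 / 20 * q ^+ n ->
  exists2 v, v != 0 & forall T, \dim T = k.+1 -> v \in T -> T \in L.
Proof.
set x := \sum_v w v => wL L0 xh.
have K3 : (3 * k.+1 <= n.+1)%N by lia.
have K2 : (k.+1 + k.+1 <= n.+1)%N by lia.
have K1 : (1 < k.+1)%N by lia.
have q3 : 3 <= q :> R by rewrite ler_nat.
set a : R := q ^+ k in xh *; set h : R := q ^+ n in xh *.
have q1 : 1 < q by lra.
have aK : q ^+ k.+1 = a * q by rewrite exprSr.
have x1 : 1 <= x.
  have [S SL] := set0Pn _ L0; have dS := weighted_dim wL SL.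
  suff : \sum_(v in S) w v <= x by rewrite (weight_sum wL dS) SL.
  by apply: (weight_le wL) => //; rewrite dS.
have a_cases : a = q \/ q ^+ 2 <= a.
  have [k1|k1] : k = 1%N \/ (2 <= k)%N by lia.
    by left; rewrite /a k1 expr1.
  by right; rewrite ler_eXn2l.
have ah : a ^+ 3 * q ^+ 2 <= h.
  by rewrite -exprM -exprD ler_eXn2l // mulnC.
have aq : q <= a by rewrite -[leLHS]expr1 ler_eXn2l.
have ha : a < h by rewrite ltr_eXn2l //; lia.
have l1 : 0 < l 1 by apply: num_over_gt0.
have rhoE : l 2 / l 1 * (h - 1) = a - 1.
  have E : l 2 * (q * h - q) = l 1 * (q * a - q).
    by have := num_overS R F n.+1 k.+1 1; rewrite !(exprS q) expr0 mulr1.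
  have q0 := lt0r_neq0 (lt_trans ltr01 q1).
  have l10 := lt0r_neq0 l1; apply: (mulfI l10); apply: (mulfI q0).
  have -> : l 1 * (l 2 / l 1 * (h - 1)) = l 2 * (h - 1).
    by rewrite mulrA [l 1 * _]mulrC divfK.
  by move: E; lra.
have hq : 0 < h - q by lra.
have rho'E : (a - q) / (h - q) * (h - q) = a - q by rewrite divfK // lt0r_neq0.
have l3E : l 3 = l 2 * ((a - q) / (h - q)).
  have E : l 3 * (q * h - q * q) = l 2 * (q * a - q * q).
    by have := num_overS R F n.+1 k.+1 2; rewrite !(exprS q) expr0 mulr1.
  apply: (mulIf (lt0r_neq0 hq)); rewrite -mulrA rho'E.
  by apply: (mulfI (lt0r_neq0 (lt_trans ltr01 q1))); move: E; lra.
have kappaE : (a * q - 1) / (q - 1) * (q - 1) = a * q - 1.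
  by rewrite divfK // lt0r_neq0 //; lra.
have := numerical_estimates q3 a_cases ah x1 xh rhoE rho'E kappaE.
set rho := l 2 / l 1; set rho' := (a - q) / (h - q).
set kappa := (a * q - 1) / (q - 1); case=> k2rho xkrho pair.
have l2E : l 2 = rho * l 1 by rewrite divfK // lt0r_neq0.
have kE : q ^+ k.+1 - 1 = kappa * (q - 1) by rewrite aK -kappaE.
rewrite -/rho' in l3E; clearbody rho rho' kappa.
have q12 : 0 < (q - 1) ^+ 2 by rewrite exprn_gt0 //; lra.
have [] := @large_clique R {vspace V} (fun S T => (S :&: T != 0)%VS) L (l 1)
  (rho * l 1 * ((1 - rho') * (2 * kappa + x - 2) + kappa ^+ 2 * x * rho')) x.
- by move=> S T; rewrite capvC.
- by move=> S SL; rewrite capvv -dimv_eq0 (weighted_dim wL SL).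
- by move=> S SL; apply: (card_family_meet wL).
- move=> S1 S2 S1L S2L /negPn/eqP S12; rewrite -(ler_pM2r q12).
  apply: le_trans (card_family_meet_two wL K1 K3 S1L S2L S12) _.
  rewrite -/x l3E l2E kE le_eqVlt; apply/orP; left.
  by apply/eqP; ring.
- exact: L0.
- exact: l1.
- by rewrite (card_family wL).
- move: pair; rewrite -(ler_pM2r l1); apply: le_trans.
  by rewrite le_eqVlt; apply/orP; left; apply/eqP; ring.
move=> A [/fintype.subsetP AL Aint Abig].
have KN : (k.+1 <= n.+1)%N by apply: leq_trans K2; rewrite leq_addl.
have dA T : T \in A -> \dim T = k.+1 by move=> /AL /(weighted_dim wL).
have [|v v0 vA] := @weak_Hilton_Milner R F n.+1 k.+1 A KN dA Aint.
  rewrite kE l2E; apply: (@lt_le_trans _ _ (l 1 / 4 * (q - 1) ^+ 2)).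
    rewrite exprMn mulrAC ltr_pM2r // mulrA; rewrite -(ltr_pM2r l1) in k2rho.
    by move: k2rho; clear; lra.
  by rewrite ler_pM2r.
exists v => //; apply: (heavy_vector wL) => //.
apply: (@lt_le_trans _ _ ((q - 1) * (l 1 / 4))).
  rewrite kE -/x l2E.
  have -> : kappa * (q - 1) * x * (rho * l 1) = (q - 1) * (x * kappa * rho * l 1) by ring.
  rewrite ltr_pM2l; last by lra.
  by rewrite -(ltr_pM2r l1) in xkrho; move: xkrho; clear; lra.
rewrite ler_pM2l; last by lra.
apply: le_trans Abig _; rewrite ler_nat; apply: subset_leq_card.
by apply/fintype.subsetP => T TA; rewrite inE AL // vA.
Qed.

(** The indicator of a pencil is the weight concentrated on its point. *)
Lemma weighted_remove_pencil (w : V -> R) (L : {set {vspace V}}) v :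
  weighted k.+1 w L -> v != 0 ->
  (forall T, \dim T = k.+1 -> v \in T -> T \in L) ->
  weighted k.+1 (fun z => w z - ((z \in <[v]>%VS) && (z != 0))%:R / (q - 1))
    [set T in L | v \notin T].
Proof.
move=> wL v0 pencil; split.
- by rewrite (weight0 wL) eqxx andbF mul0r subr0.
- by move=> T; rewrite inE => /andP[/(weighted_dim wL)].
move=> T dT; rewrite sumrB (weight_sum wL dT) -mulr_suml.
have q10 : q - 1 != 0 by rewrite lt0r_neq0 // subr_gt0 card_gt1.
have -> : \sum_(z in T) ((z \in <[v]>%VS) && (z != 0))%:R = (v \in T)%:R * (q - 1).
  case: (boolP (v \in T)) => vT.
    rewrite mul1r -[q]expr1.
    have := sum1_nonzero R <[v]>%VS; rewrite dim_vline v0 => <-.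
    rewrite [LHS]big_mkcond [RHS]big_mkcond /=; apply: eq_bigr => z _.
    case: (boolP (z \in <[v]>%VS)) => [/vlineP[c ->]|_]; last by case: ifP.
    by rewrite rpredZ //=; case: (c *: v != 0).
  rewrite mul0r big1 // => z zT; case: andP => // -[zv z0].
  by move: vT; rewrite (mem_line_sym v0 z0) in zv; case/vlineP: zv => c ->; rewrite rpredZ.
rewrite mulfK // inE; case: (boolP (v \in T)) => vT; last by rewrite andbT subr0.
by rewrite (pencil _ dT vT) subrr.
Qed.

Lemma sum_remove_pencil (w : V -> R) v : v != 0 ->
  \sum_z (w z - ((z \in <[v]>%VS) && (z != 0))%:R / (q - 1)) = \sum_z w z - 1.
Proof.
move=> v0; rewrite sumrB -mulr_suml; congr (_ - _).
have q10 : q - 1 != 0 by rewrite lt0r_neq0 // subr_gt0 card_gt1.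
have := sum1_nonzero R <[v]>%VS; rewrite dim_vline v0 expr1 => E.
apply: (mulIf q10); rewrite divfK // mul1r -E [RHS]big_mkcond /=.
by apply: eq_bigr => z _; case: andP.
Qed.

(** Otherwise L contains a pencil, and what remains of L without it is nonempty
    of parameter x - 1 and contains another one.  The two pencils share a
    K-space, since K >= 2. *)
Lemma weighted_sum_lt2 (w : V -> R) (L : {set {vspace V}}) : weighted k.+1 w L ->
  (\sum_v w v) ^+ 2 * (q ^+ k) ^+ 2 <= 17 / 20 * q ^+ n -> \sum_v w v < 2.
Proof.
move=> wL small; rewrite ltNge; apply/negP => x2.
have nonempty (w' : V -> R) (L' : {set {vspace V}}) :
    weighted k.+1 w' L' -> 0 < \sum_v w' v -> L' != finset.set0.
  move=> wL' x0; rewrite -cards_eq0 -lt0n -(ltr0n R) (card_family wL').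
  by rewrite mulr_gt0 // num_over_gt0.
have L0 : L != finset.set0 by apply: (nonempty _ _ wL); lra.
have [v v0 pencil] := exists_pencil wL L0 small.
have wL' := weighted_remove_pencil wL v0 pencil.
have xE := sum_remove_pencil w v0.
have [||v' v'0 pencil'] := exists_pencil wL' _ _.
- by apply: (nonempty _ _ wL'); rewrite xE; lra.
- apply: le_trans small; rewrite ler_wpM2r ?sqr_ge0 // xE.
  by move: (\sum_v w v) x2 => x x2; nra.
pose U := (<[v]> + <[v']>)%VS.
have dU : (\dim U <= 2)%N.
  have := dimv_sum_cap <[v]>%VS <[v']>%VS.
  rewrite !dim_vline v0 v'0 -/U => E.
  by apply: (@leq_trans (\dim U + \dim (<[v]> :&: <[v']>))%N); rewrite ?leq_addr // E.
have : 0 < num_over R F n.+1 k.+1 (\dim U).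
  by apply: num_over_gt0; apply: leq_trans dU _.
rewrite -card_kspaces_over ltr0n => /card_gt0P[T]; rewrite !inE => /andP[/eqP dT].
rewrite subv_add -!memvE => /andP[vT v'T].
by have := pencil' T dT v'T; rewrite inE vT andbF.
Qed.

End Pencils.

(** * Cameron-Liebler sets as weighted families *)

(** Projecting from a point identifies the K-spaces through it with the
    (K - 1)-spaces of the quotient; numerically, the factors of the two products
    agree up to a power of q. *)
Lemma num_over_gauss (R : realFieldType) (F : finFieldType) n k :
  num_over R F n.+1 k.+1 1 = num_over R F n k 0.
Proof.
rewrite /num_over /= /num_kspaces big_add1 /=; apply: eq_bigr => i _.
have q0 : (#|F|%:R : R) != 0 by rewrite lt0r_neq0 // (lt_trans ltr01) // card_gt1.
by rewrite !addn0 !exprS -!mulrBr -mulf_div divff // mul1r.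
Qed.

Lemma gauss_binomE (R : realFieldType) (F : finFieldType) n k :
  (gauss_binom F n k)%:R = num_over R F n k 0.
Proof.
have := @card_kspaces_over R F n k 0%VS; rewrite dimv0 => <-; congr _%:R.
by apply: eq_card => T; rewrite !inE sub0v andbT.
Qed.

(** The coefficients that express the characteristic vector in terms of the rows of
    the incidence matrix are the weights of the points. *)
Lemma cameron_liebler_weighted (R : realType) (F : finFieldType) n k
    (L : {set kspace F n k}) : cameron_liebler R L ->
  exists w : 'rV[F]_n.+1 -> R,
    weighted k.+1 w [set val S | S in L].
Proof.
move=> /submxP[D LE]; pose W (p : Defs.point F n) : R := D ord0 (enum_rank p).
set q : R := #|F|%:R.
have q10 : q - 1 != 0 by rewrite lt0r_neq0 // subr_gt0 card_gt1.
exists (fun v => if v == 0 then 0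
  else \sum_(p : Defs.point F n | v \in val p) W p / (q - 1)); split.
- by rewrite eqxx.
- by move=> _ /imsetP[S _ ->]; apply/eqP/(valP S).
move=> T dT; have dT' : \dim T == k.+1 by apply/eqP.
pose S : kspace F n k := exist _ T dT'.
have -> : (T \in [set val U | U in L]) = (S \in L).
  by rewrite -[T]/(val S) mem_imset //; exact: val_inj.
have <- : char_vec R L ord0 (enum_rank S) = (S \in L)%:R.
  by rewrite mxE enum_rankK.
rewrite LE mxE [RHS](reindex (@enum_rank (Defs.point F n))) /=; last first.
  by apply: onW_bij; exact: enum_rank_bij.
rewrite (bigD1 0) ?mem0v //= eqxx add0r.
under eq_bigr => v /andP[_ v0] do rewrite (negbTE v0).
rewrite (exchange_big_dep predT) //=; apply: eq_bigr => p _.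
rewrite !mxE !enum_rankK -/(W p).
have dp : \dim (val p) = 1%N by apply/eqP/(valP p).
case: (boolP (val p <= T)%VS) => pT.
  rewrite mulr1.
  have := sum_nonzero_const (W p / (q - 1)) (val p).
  rewrite dp expr1 [X in _ = X]mulrC divfK // => E.
  apply: etrans E; apply: eq_bigl => v.
  rewrite andbAC; case: (boolP (v \in val p)) => vp; last by rewrite andbF.
  by rewrite (subvP pT v vp) andbT.
rewrite mulr0 big1 // => v /andP[/andP[vT v0] vp]; case/negP: pT.
suff -> : val p = <[v]>%VS by rewrite -memvE.
apply/esym/eqP; rewrite eqEdim -memvE vp dp dim_vline v0 //.
Qed.

Lemma parameter_weight (R : realType) (F : finFieldType) n k
    (L : {set kspace F n k}) (w : 'rV[F]_n.+1 -> R) : (k <= n)%N ->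
  weighted k.+1 w [set val S | S in L] -> ratr (parameter L) = \sum_v w v.
Proof.
move=> kn wL; rewrite /parameter fmorph_div !rmorph_nat gauss_binomE.
have := card_family wL; rewrite card_imset; last exact: val_inj.
rewrite num_over_gauss => ->; rewrite mulfK // lt0r_neq0 //.
by rewrite /num_over /= num_kspaces_gt0.
Qed.

(** Squaring turns the exponents into n - k^2/2 - 3k/2 - 3 for q and
    k(k - 1)/2 + 1 for q - 1.  Bounding (q - 1)^(k(k - 1)/2) by the same power of q,
    and (q - 1) (q^2 + q + 1) by q^3, leaves q^(n - 2k). *)
Lemma bound_sqr_le (R : realType) (q : R) (n k : nat) (x : R) : 3 <= q ->
  0 <= x -> x <= (2 `^ (8^-1))^-1
            * q `^ (n%:R / 2 - k%:R ^+ 2 / 4 - 3 * k%:R / 4 - 3 / 2)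
            * (q - 1) `^ (k%:R ^+ 2 / 4 - k%:R / 4 + 1 / 2)
            * Num.sqrt (q ^+ 2 + q + 1) ->
  x ^+ 2 * (q ^+ k) ^+ 2 <= 17 / 20 * q ^+ n.
Proof.
move=> q3 x0 xb; set K : R := k%:R in xb.
have q0 : 0 < q by lra.
have q10 : 0 < q - 1 by lra.
have KK : 0 <= K ^+ 2 / 2 - K / 2.
  rewrite /K; case: k {xb K} => [|k]; first by rewrite expr0n /=; lra.
  by have := ler0n R k; rewrite -natr1; nra.
have sqr_powR (a e : R) : 0 < a -> (a `^ e) ^+ 2 = a `^ (2 * e).
  by move=> a0; rewrite mulrC powRrM powR_mulrn // powR_ge0.
set c := 2 `^ 8^-1 in xb.
have c_sqr : (c^-1) ^+ 2 <= 17 / 20.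
  have c0 : 0 < c by apply: powR_gt0.
  have c8 : c ^+ 8 = 2.
    by rewrite -powR_mulrn ?(ltW c0) // /c -powRrM mulVf // powRr1.
  (* Indeed (20/17)^4 < 2 = c^8. *)
  have c2 : 20 / 17 <= c ^+ 2.
    rewrite leNgt; apply/negP => c2.
    have : (c ^+ 2) ^+ 4 < (20 / 17) ^+ 4.
      by rewrite ltr_pXn2r // nnegrE ?sqr_ge0 //; lra.
    by rewrite -exprM c8; lra.
  by rewrite exprVn -[_^-1]mul1r ler_pdivrMr ?exprn_gt0 //; lra.
set P := q `^ (n%:R - K ^+ 2 / 2 - 3 * K / 2 - 3).
set Q := (q - 1) `^ (K ^+ 2 / 2 - K / 2).
have P0 : 0 < P by apply: powR_gt0.
have Q0 : 0 < Q by apply: powR_gt0.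
have xb2 : x ^+ 2 <= (c^-1) ^+ 2 * (P * (Q * (q - 1)) * (q ^+ 2 + q + 1)).
  have x2 := lerXn2r 2 x0 (le_trans x0 xb) xb.
  apply: (le_trans x2); rewrite !exprMn !sqr_powR // sqr_sqrtr; last by nra.
  have -> : 2 * (K ^+ 2 / 4 - K / 4 + 1 / 2) = (K ^+ 2 / 2 - K / 2) + 1 by field.
  have -> : 2 * (n%:R / 2 - K ^+ 2 / 4 - 3 * K / 4 - 3 / 2)
    = n%:R - K ^+ 2 / 2 - 3 * K / 2 - 3 by field.
  by rewrite [(q - 1) `^ _]powRD ?lt0r_neq0 ?implybT // -/P -/Q powRr1 ?(ltW q10) // -!mulrA.
apply: le_trans (ler_wpM2r (sqr_ge0 _) xb2) _; rewrite -[leLHS]mulrA.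
have s0 : 0 <= q ^+ 2 + q + 1 by rewrite !addr_ge0 ?sqr_ge0 ?(ltW q0).
have cubes : (q - 1) * (q ^+ 2 + q + 1) <= q ^+ 3 by lra.
have Qle : Q <= q `^ (K ^+ 2 / 2 - K / 2).
  by apply: ge0_ler_powR; rewrite ?nnegrE //; lra.
have PE : P * q `^ (K ^+ 2 / 2 - K / 2) * q ^+ 3 * (q ^+ k) ^+ 2 = q ^+ n.
  rewrite -exprM -!(powR_mulrn _ (ltW q0)) -!powRD ?(lt0r_neq0 q0) ?implybT //.
  by congr (_ `^ _); rewrite natrM -/K; field.
set Z := q `^ (K ^+ 2 / 2 - K / 2) in Qle PE.
rewrite -PE; apply: ler_pM => //.
- exact: sqr_ge0.
- apply: mulr_ge0; last exact: sqr_ge0.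
  apply: mulr_ge0 _ s0; apply: mulr_ge0 (ltW P0) _; exact: mulr_ge0 (ltW Q0) (ltW q10).
rewrite ler_wpM2r ?sqr_ge0 // -!mulrA ler_wpM2l ?(ltW P0) //.
by apply: ler_pM Qle cubes; [exact: ltW | exact: mulr_ge0 (ltW q10) s0].
Qed.

Theorem theorem4p14 (R : realType) (F : finFieldType) (q n k : nat)
    (cardF : #|F| = q) (q_ge3 : (3 <= q)%N)
    (k_ge1 : (1 <= k)%N) (n_ge : (3 * k + 2 <= n)%N) :
  ~ exists L : {set kspace F n k},
      [/\ cameron_liebler R L,
          2 <= ratr (parameter L) :> R &
          ratr (parameter L) <=
            (2 `^ (8^-1))^-1
            * q%:R `^ (n%:R / 2 - k%:R ^+ 2 / 4 - 3 * k%:R / 4 - 3 / 2)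
            * (q%:R - 1) `^ (k%:R ^+ 2 / 4 - k%:R / 4 + 1 / 2)
            * Num.sqrt (q%:R ^+ 2 + q%:R + 1) :> R].
Proof.
case: _ / cardF q_ge3 => q_ge3 [L [/cameron_liebler_weighted[w wL]]].
have kn : (k <= n)%N by lia.
rewrite (parameter_weight kn wL) => x2 /bound_sqr_le.
rewrite ler_nat => /(_ q_ge3 (le_trans (ler0n _ 2) x2)) small.
by have := weighted_sum_lt2 q_ge3 k_ge1 n_ge wL small; rewrite ltNge x2.
Qed.
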